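(* Let $\xi>0$ be a constant and $\delta=\xi m$, where $m=m(n)$ and $r=r(n)$ may depend on $n$. Let $G_n^{\mathrm H}$ and $G_n^{\mathrm S}$ be the hybrid model and the self-loop model on $n$ vertices with parameters $m,r,\delta$. 1. For any $m\ge 1$ and $r>0$, with high probability the diameter of $G_n^{\mathrm H}$ is $O(\ln n)$. 2. There is a constant $K_1(\xi)$ depending on $\xi$ such that for any $m\ge K_1(\xi)\ln n$ and $r>0$, with high probability the diameter of $G_n^{\mathrm S}$ is $O(\ln n)$.
   Context: ''With high probability'' means with probability $1-o(1)$ as $n\to\infty$. Let $S$ be a sphere of unit area (radius $\frac1{2\sqrt\pi}$), $\|\cdot\|$ the angular distance on $S$, and $B_R(v)=\{u\in S:\|u-v\|\le R\}$. A self-loop counts as degree $1$. All graphs are multigraphs; $V_t=\{x_1,\dots,x_t\}$ is the vertex set at time $t$. $n$ is the number of vertices generated; $m$ is a positive integer. Base model. $G_1$ consists of a uniformly random point $x_1\in S$ with $2m$ self-loops. At time $t+1$ ($t\ge1$), a new vertex $x_{t+1}$ is drawn uniformly from $S$ (independently of the past). If $B_r(x_{t+1})\cap V_t=\emptyset$, then $2m$ self-loops are added to $x_{t+1}$. Otherwise $m$ contacts $y_1^{t+1},\dots,y_m^{t+1}$ are chosen independently (with replacement) from $B_r(x_{t+1})\cap V_t$, with $$\Pr[y_i^{t+1}=v]=\frac{\deg_t(v)+\delta}{\sum_{w\in B_r(x_{t+1})\cap V_t}(\deg_t(w)+\delta)},$$ where $\deg_t(v)$ is the degree of $v$ in $G_t$,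 and the edges $(x_{t+1},y_i^{t+1})$ are added. Hybrid model $G_t^{\mathrm H}$. Edges are either local or long. $G_1^{\mathrm H}=G_1$ with all its self-loops local. At time $t+1$, a uniform vertex $x_{t+1}$ is added, its local edges are created as in the base model with $\deg_t(v)$ denoting the local-degree of $v$ (number of local edges at $v$), and then one long edge $(x_{t+1},z)$ is added with $z$ uniform in $\{x_1,\dots,x_t\}$. Self-loop model $G_t^{\mathrm S}$ (here $\delta\ge2$ is an integer). $G_1^{\mathrm S}$ consists of a uniform point $x_1\in S$ with $2m+\delta$ self-loops, $\delta$ of which are marked flexible. At time $t+1$, a uniform vertex $x_{t+1}$ is added together with $\delta$ flexible self-loops; its non-flexible edges are created as in the base model with $\deg_t(v)$ denoting the number of non-flexible edges incident to $v$; then a vertex $z$ is chosen uniformly from the vertices among $x_1,\dots,x_t$ that have at least one flexible self-loop, one flexible self-loop is deleted from each of $x_{t+1}$ and $z$, and an edge $(x_{t+1},z)$, marked flexible, is added. *)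

(* Defs.v *)
From HB Require Import structures.
From mathcomp Require Import all_boot all_order all_algebra.
From mathcomp Require Import all_classical all_reals all_analysis.

Set Implicit Arguments.
Unset Strict Implicit.
Unset Printing Implicit Defensive.

Import Order.TTheory GRing.Theory Num.Theory.
Import numFieldNormedType.Exports.

Local Open Scope classical_set_scope.
Local Open Scope ring_scope.

Section Sphere.
Variable R : realType.

Definition point3 : Type :=
  (measurableTypeR R * measurableTypeR R * measurableTypeR R)%type.

Definition dot (u v : point3) : R :=
  u.1.1 * v.1.1 + u.1.2 * v.1.2 + u.2 * v.2.

Definition radius : R := (2 * Num.sqrt pi)^-1.

Definition sphere : set point3 := [set u | Num.sqrt (dot u u) = radius].

Definition angle (u v : point3) : R :=
  acos (dot u v / (Num.sqrt (dot u u) * Num.sqrt (dot v v))).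

(* Colatitude [phi], longitude [theta]. *)
Definition spherical (phi theta : R) : point3 :=
  (radius * (sin phi * cos theta), radius * (sin phi * sin theta),
   radius * cos phi).

(* Surface area of [B] intersected with the sphere, as the surface integral
   with area element [radius ^+ 2 * sin phi]. As the total area is 1, this is
   also the uniform distribution on the sphere. *)
Definition area (B : set point3) : \bar R :=
  (\int[lebesgue_measure]_(theta in `[0%R, (2 * pi)%R])
    \int[lebesgue_measure]_(phi in `[0%R, pi])
      (\1_B (spherical phi theta) * (radius ^+ 2 * sin phi))%:E)%E.

End Sphere.

(* A multigraph on {0, ..., n-1} is the list of its edges, with repetitions; the
   orientation of the pairs is irrelevant. *)
Definition edges := seq (nat * nat).

(* A self-loop counts once. *)
Definition deg (E : edges) (v : nat) : nat :=
  count (fun e => (e.1 == v) || (e.2 == v)) E.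

Section Diameter.
Variables (R : realType) (n : nat) (E : edges).

Definition adj : rel 'I_n := fun u v =>
  ((val u, val v) \in E) || ((val v, val u) \in E).

(* [+oo] if no path joins [u] to [v]. *)
Definition gdist (u v : 'I_n) : \bar R :=
  ereal_inf [set ((size p)%:R)%:E | p in
    [set p : seq 'I_n | path adj u p /\ last u p = v]].

Definition diameter : \bar R :=
  ereal_sup [set gdist uv.1 uv.2 | uv in [set: 'I_n * 'I_n]].

End Diameter.

(* Vertices are numbered from 0: vertex [t] is the one called x_{t+1} in the
   usual numbering; when it arrives, the existing vertices are those of ['I_t].
   [x t] is its position, [y t 0], ..., [y t (m-1)] are its local contacts and
   [z t] is the other endpoint of its long (hybrid model) or flexible
   (self-loop model) edge. The values of [y t] when vertex [t] is isolated on
   arrival, and those of [y 0] and [z 0], are not used. *)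

Section Evolution.
Variables (R : realType) (m : nat) (r : R).
Variables (x : nat -> point3 R) (y : nat -> 'I_m -> nat) (z : nat -> nat).

Definition near_new (t v : nat) : bool := angle (x v) (x t) <= r.

Definition isolated (t : nat) : bool := [forall v : 'I_t, ~~ near_new t v].

(* The edges of the base model among the first [t] vertices; also the local
   edges of the hybrid model and the non-flexible edges of the self-loop model.
   The first vertex is isolated on arrival and gets [2 * m] self-loops. *)
Fixpoint local_edges (t : nat) : edges :=
  if t is s.+1 then
    local_edges s ++
      (if isolated s then nseq (2 * m)%N (s, s)
       else [seq (s, y s i) | i <- enum 'I_m])
  else [::].

Definition weight (delta : R) (t v : nat) : R :=
  (deg (local_edges t) v)%:R + delta.

(* Probability that a given contact of vertex [t] is [v]. *)
Definition contact_prob (delta : R) (t : nat) (v : 'I_t) : R :=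
  if near_new t v then
    weight delta t v / \sum_(w < t | near_new t w) weight delta t w
  else 0.

Definition long_edges (t : nat) : edges := [seq (s, z s) | s <- iota 1 t.-1].

(* The flexible edges of the self-loop model, flexible self-loops included. *)
Fixpoint flexible_edges (k : nat) (t : nat) : edges :=
  if t is s.+1 then
    let F := flexible_edges k s ++ nseq k (s, s) in
    if s == 0%N then F
    else (s, z s) :: rem (s, s) (rem (z s, z s) F)
  else [::].

Definition has_flexible_loop (k t : nat) (v : 'I_t) : bool :=
  (val v, val v) \in flexible_edges k t.

Definition hybrid_edges (t : nat) : edges := local_edges t ++ long_edges t.

Definition self_loop_edges (k t : nat) : edges :=
  local_edges t ++ flexible_edges k t.

End Evolution.

Record process (d : measure_display) (T : measurableType d) (R : realType)
    (m : nat) := Process {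
  pos : nat -> {mfun T >-> point3 R};
  contact : nat -> 'I_m -> {mfun T >-> nat};
  extra : nat -> {mfun T >-> nat}
}.

Section Models.
Variables (R : realType) (d : measure_display) (T : measurableType d).
Variable P : probability T R.

(* [p] is a version of the conditional probability of [A] given the
   sigma-algebra [F]. *)
Definition cond_prob (F : set (set T)) (A : set T) (p : T -> R) : Prop :=
  (forall B : set (measurableTypeR R), measurable B -> F (p @^-1` B)) /\
  (forall E, F E -> P (E `&` A) = (\int[P]_(w in E) (p w)%:E)%E).

Definition events d' (U : measurableType d') (f : T -> U) : set (set T) :=
  preimage_set_system setT f measurable.

Variables (m : nat) (X : process T R m).

Definition posw (w : T) : nat -> point3 R := fun s => pos X s w.
Definition contactw (w : T) : nat -> 'I_m -> nat := fun s i => contact X s i w.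
Definition extraw (w : T) : nat -> nat := fun s => extra X s w.

(* The sigma-algebra generated by the positions of the first [a] vertices, the
   contacts of the first [b] and the long/flexible edges of the first [c]. *)
Definition history (a b c : nat) : set (set T) :=
  <<s \bigcup_(s in `I_a) events (pos X s)
      `|` \bigcup_(s in `I_b) \bigcup_(i in [set: 'I_m]) events (contact X s i)
      `|` \bigcup_(s in `I_c) events (extra X s) >>.

(* The third clause says that [pos X t] is uniform on the sphere and independent
   of the past; the fourth that, given the past and [pos X t], the contacts of a
   non-isolated [t] are independent with law [contact_prob]. *)
Definition base_law (r delta : R) : Prop :=
  [/\ forall t w, sphere (pos X t w),
      forall t i w, (0 < t)%N -> (contact X t i w < t)%N,
      forall t E (B : set (point3 R)), history t t t E -> measurable B ->
        P (E `&` pos X t @^-1` B) = (P E * area B)%E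
    & forall t (v : {ffun 'I_m -> 'I_t}), (0 < t)%N ->
        cond_prob (history t.+1 t t)
          [set w | ~~ isolated r (posw w) t /\
                   forall i, contact X t i w = v i :> nat]
          (fun w => if isolated r (posw w) t then 0 else
             \prod_(i < m)
               contact_prob r (posw w) (contactw w) delta (v i))].

Definition hybrid_model (r delta : R) : Prop :=
  [/\ base_law r delta,
      forall t w, (0 < t)%N -> (extra X t w < t)%N
    & forall t (v : 'I_t),
        cond_prob (history t.+1 t.+1 t) [set w | extra X t w = v :> nat]
          (fun=> t%:R^-1)].

Definition self_loop_model (r : R) (k : nat) : Prop :=
  [/\ base_law r k%:R,
      forall t w, (0 < t)%N -> (extra X t w < t)%N
    & forall t (v : 'I_t),
        cond_prob (history t.+1 t.+1 t) [set w | extra X t w = v :> nat]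
          (fun w => if has_flexible_loop (extraw w) k v then
             (#|[pred u : 'I_t | has_flexible_loop (extraw w) k u]|%:R)^-1
           else 0)].

Definition hybrid_graph (r : R) (n : nat) (w : T) : edges :=
  hybrid_edges r (posw w) (contactw w) (extraw w) n.

Definition self_loop_graph (r : R) (k n : nat) (w : T) : edges :=
  self_loop_edges r (posw w) (contactw w) (extraw w) k n.

End Models.

Definition whp (R : realType) (d : nat -> measure_display)
    (T : forall n, measurableType (d n)) (P : forall n, probability (T n) R)
    (A : forall n, set (T n)) : Prop :=
  (fun n => P n (A n)) @ \oo --> 1%E.

(* Main.v *)
Require Import Defs.
From HB Require Import structures.
From mathcomp Require Import all_boot all_order all_algebra.
From mathcomp Require Import all_classical all_reals all_analysis.
From mathcomp Require Import measurable_realfun zify ring lra.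

Set Implicit Arguments.
Unset Strict Implicit.
Unset Printing Implicit Defensive.

Import Order.TTheory GRing.Theory Num.Theory.
Import numFieldNormedType.Exports.

(** Only the long (respectively flexible) edges are needed for the upper bound
    on the diameter. They form a tree rooted at vertex 0, in which the parent of
    [t] is [z t < t], and the diameter is at most twice the height of that tree.

    In both models, given the past, the parent of [t] equals any fixed [v < t]
    with probability at most [2 / t]. In the hybrid model this probability is
    [1 / t]. In the self-loop model it is one over the number of vertices that
    still have a flexible loop: [k * t] loops have been created and at most
    [2 * (t - 1)] deleted, while no vertex holds more than [k], so that for
    [4 <= k] at least half of the vertices have one
    ([half_have_flexible_loop]). As [k = xi * m >= xi * ln n] in the self-loop
    model with [K1 = 1], the condition [4 <= k] holds for large [n].

    The height is then bounded by a first moment computation. Let [a j t] be the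
    expected number of vertices [s < t] of depth more than [j]. Since [t] has
    depth more than [j + 1] exactly when its parent has depth more than [j],
    one has [a (j + 1) (t + 1) <= a (j + 1) t + 2 / t * a j t], whence
    [a j t <= t ^ 4 / 2 ^ j] ([height_tail]). For [j] about [10 * ln n] this is
    at most [2 / n], so with high probability all depths are at most
    [10 * ln n] and the diameter is at most [20 * ln n].

    A probability is an arbitrary function off the measurable sets, so the event
    on the diameter must also be shown measurable. The graph is a function of
    finitely many discrete random variables: the contacts, the extra endpoints
    and the isolation indicators. The latter are measurable because the angle
    between points of the sphere is a monotone function of their scalar
    product. *)

Local Open Scope classical_set_scope.
Local Open Scope ring_scope.

(** * Trees given by a parent function *)

(** The root is made its own parent, so that the [j]-th ancestor is an iterate
    and depth at most [j] means that this iterate is 0. *)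
Definition parent (z : nat -> nat) (t : nat) : nat :=
  if t == 0%N then 0%N else z t.

Lemma parentE z t : (0 < t)%N -> parent z t = z t.
Proof. by case: t. Qed.

Lemma iter_parent0 z j : iter j (parent z) 0 = 0%N.
Proof. by elim: j => //= j ->. Qed.

Lemma adjC n (E : edges) : symmetric (@adj n E).
Proof. by move=> u v; rewrite /adj orbC. Qed.

Lemma path_to_root n (E : edges) z :
    (forall s, (0 < s < n)%N -> (z s < s)%N && ((s, z s) \in E)) ->
  forall j (u : 'I_n), iter j (parent z) u = 0%N ->
  exists p : seq 'I_n,
    [/\ path (adj E) u p, last u p = 0%N :> nat & (size p <= j)%N].
Proof.
move=> zE; elim=> [|j IHj] u; first by move=> /= u0; exists [::].
have [u0 _|u0] := posnP u; first by exists [::].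
have /zE/andP[zu uE] : (0 < u < n)%N by rewrite u0 ltn_ord.
rewrite iterSr parentE// => it0.
have [p [pp lp sp]] := IHj (Ordinal (ltn_trans zu (ltn_ord u))) it0.
by exists (Ordinal (ltn_trans zu (ltn_ord u)) :: p); split => //=;
  rewrite pp andbT /adj /= uE.
Qed.

(** Two vertices are joined by climbing from one to the root and descending to
    the other. *)
Lemma diameter_le_double_height (R : realType) n (E : edges) z k :
    (forall s, (0 < s < n)%N -> (z s < s)%N && ((s, z s) \in E)) ->
    (forall s, (s < n)%N -> iter k (parent z) s = 0%N) ->
  (diameter R n E <= (2 * k%:R)%:E)%E.
Proof.
move=> zE dead; apply: ge_ereal_sup => _ [[u v] _ <-] /=.
have [p [pp lp sp]] := path_to_root zE (dead u (ltn_ord u)).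
have [q [pq lq sq]] := path_to_root zE (dead v (ltn_ord v)).
have lpq : last u p = last v q by apply: val_inj; rewrite /= lp lq.
apply: ge_ereal_inf; exists (size (p ++ rev (belast v q)))%:R%:E.
  exists (p ++ rev (belast v q)) => //; split.
    rewrite cat_path pp lpq rev_path.
    by under eq_path => a b do rewrite adjC.
  by rewrite last_cat lpq; case: (q) => //= a q'; rewrite rev_cons last_rcons.
by rewrite lee_fin size_cat size_rev size_belast -natrM ler_nat mul2n -addnn leq_add.
Qed.

(** * Flexible self-loops *)

Definition loops_at (v : nat) (E : edges) : nat := count_mem (v, v) E.

Lemma loops_atS k z t v : (forall s, (0 < s < t.+1)%N -> (z s < s)%N) -> (0 < t)%N ->
  loops_at v (flexible_edges z k t.+1) =
  (loops_at v (flexible_edges z k t) + k * (t == v) - (z t == v) - (t == v))%N.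
Proof.
move=> zlt t0; have zt : (z t < t)%N by rewrite zlt// t0 ltnSn.
rewrite /loops_at /= eqn0Ngt t0 /= !count_mem_rem count_cat count_nseq /=.
rewrite !xpair_eqE !andbb mulnC.
by have [<-|_] //= := eqVneq t v; rewrite (ltn_eqF zt).
Qed.

Lemma loops_at_le k z t v : (forall s, (0 < s < t)%N -> (z s < s)%N) ->
  (loops_at v (flexible_edges z k t) <= (v < t) * k)%N.
Proof.
elim: t => [//|t IHt] zlt.
have {}IHt : (loops_at v (flexible_edges z k t) <= (v < t) * k)%N.
  by apply: IHt => s /andP[s0 st]; rewrite zlt// s0 ltnW.
have [t0|t0] := posnP t.
  subst t; rewrite /loops_at /= count_nseq /= xpair_eqE andbb.
  by rewrite ltnS leqn0 eq_sym.
rewrite loops_atS//; apply: leq_trans (leq_subr _ _) _.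
apply: leq_trans (leq_subr _ _) _.
apply: leq_trans (leq_add IHt (leqnn _)) _.
rewrite [(v < t.+1)%N]ltnS [(v <= t)%N]leq_eqVlt.
rewrite [t == v]eq_sym [(k * _)%N]mulnC -mulnDl leq_mul2r.
by case: (ltngtP v t); rewrite ?orbT.
Qed.

(** A new vertex brings [k] loops and each step deletes at most two; fewer
    when [z] picks a vertex without loop, as [rem] then does nothing. *)
Lemma sum_loops_at_ge k z t : (1 < k)%N -> (0 < t)%N ->
  (forall s, (0 < s < t)%N -> (z s < s)%N) ->
  (k * t <= \sum_(v < t) loops_at v (flexible_edges z k t) + 2 * t.-1)%N.
Proof.
move=> k1; elim: t => [//|t IHt] _ zlt.
have zlt' s : (0 < s < t)%N -> (z s < s)%N.
  by move=> /andP[s0 st]; rewrite zlt// s0 ltnW.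
have [t0|t0] := posnP t.
  subst t; rewrite big_ord_recl big_ord0 /loops_at /= count_nseq /=.
  by rewrite muln1 mul1n !addn0.
have zt : (z t < t)%N by rewrite zlt// t0 ltnSn.
have {}IHt := IHt t0 zlt'.
rewrite big_ord_recr /= loops_atS// eqxx muln1 (ltn_eqF zt) subn0.
have -> : loops_at t (flexible_edges z k t) = 0%N.
  by apply/eqP; rewrite -leqn0 (leq_trans (loops_at_le k t zlt'))// ltnn.
(* Among the old vertices only [z t] can lose a loop. *)
have : (\sum_(v < t) loops_at v (flexible_edges z k t) <=
        \sum_(v < t) loops_at v (flexible_edges z k t.+1) + 1)%N.
  have -> : 1%N = (\sum_(v < t) (z t == v))%N.
    rewrite (bigD1 (Ordinal zt)) //= eqxx big1 // => v.
    by rewrite -val_eqE /= eq_sym => /negbTE->.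
  rewrite -big_split leq_sum//= => v _; rewrite loops_atS//.
  by rewrite [t == v]gtn_eqF// muln0 addn0 subn0 addnC -leq_subLR.
move: IHt; rewrite -(ltn_predK t0) /= => *; nia.
Qed.

(** With [c] vertices having a loop, the two bounds above give
    [k * t <= k * c + 2 * t.-1], which for [4 <= k] forces [t <= 2 * c]. *)
Lemma half_have_flexible_loop k z t : (3 < k)%N ->
  (forall s, (0 < s < t)%N -> (z s < s)%N) ->
  (t <= 2 * #|[pred u : 'I_t | has_flexible_loop z k u]|)%N.
Proof.
move=> k3 zlt; have [->//|t0] := posnP t.
have := sum_loops_at_ge (ltnW (ltnW k3)) t0 zlt.
have : (\sum_(v < t) loops_at v (flexible_edges z k t) <=
        k * #|[pred u : 'I_t | has_flexible_loop z k u]|)%N.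
  rewrite -sum1_card big_distrr /= [leqRHS]big_mkcond/= leq_sum// => v _.
  rewrite inE /has_flexible_loop; case: ifP => [_|/negbT/count_memPn].
    by rewrite muln1 (leq_trans (loops_at_le k v zlt))// ltn_ord mul1n.
  by rewrite /loops_at => ->.
set c := #|_|; set S := (\sum_(v < t) _)%N => *.
rewrite leqNgt; apply/negP => ?; nia.
Qed.

(** Deletions only affect self-loops, and [(s, z s)] is not one. *)
Lemma flexible_edge_mem k z t : (forall s, (0 < s < t)%N -> (z s < s)%N) ->
  forall s, (0 < s < t)%N -> (s, z s) \in flexible_edges z k t.
Proof.
elim: t => [_ s|t IHt zlt s /andP[s0]]; first by rewrite ltn0 andbF.
rewrite ltnS leq_eqVlt => /predU1P[<-|st] /=.
  by rewrite gtn_eqF// inE eqxx.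
have zs : (z s < s)%N by apply: zlt; rewrite s0 ltnW.
rewrite gtn_eqF; last exact: leq_ltn_trans st.
rewrite inE; apply/orP; right.
have nloop v : (s, z s) != (v, v).
  by rewrite xpair_eqE; apply/negP => /andP[/eqP<-]; rewrite (ltn_eqF zs).
rewrite !rem_mem// mem_cat IHt ?s0//.
by move=> u /andP[u0 ut]; rewrite zlt// u0 ltnW.
Qed.

(** * Discrete random variables *)

(** Measurability with respect to the discrete sigma-algebra on [U]: every
    function of a discrete variable is again discrete, so that graph-valued
    variables can be built up by the same recursions as the graphs. *)
Definition discrete_wrt (T U : Type) (F : set (set T)) (f : T -> U) : Prop :=
  forall B : set U, F (f @^-1` B).

Section DiscreteVariables.
Variables (T : Type) (F : set (set T)).
Hypothesis sF : sigma_algebra setT F.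

Lemma discrete_wrt_cst (U : Type) (u : U) : discrete_wrt F (fun=> u).
Proof.
case: sF => F0 FC _ B; have [Bu|NBu] := pselect (B u).
  by rewrite (_ : _ @^-1` _ = setT `\` set0)//; [exact: FC|
    rewrite setD0; apply/seteqP; split].
by rewrite (_ : _ @^-1` _ = set0)//; apply/seteqP; split.
Qed.

Lemma discrete_wrt_comp (U V : Type) (f : T -> U) (g : U -> V) :
  discrete_wrt F f -> discrete_wrt F (fun w => g (f w)).
Proof. by move=> Ff B; exact: (Ff (g @^-1` B)). Qed.

(** Decompose the event according to the countably many values of [f]. Only
    the values that [f] takes are asked about in the assumption on [g]: for an
    ancestor these are small indices, and the history at time [t] only contains
    the parents of earlier vertices. *)
Lemma discrete_wrt_bind (U : countType) (V : Type) (f : T -> U) (g : U -> T -> V) :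
    discrete_wrt F f -> (forall w, discrete_wrt F (g (f w))) ->
  discrete_wrt F (fun w => g (f w) w).
Proof.
case: sF => F0 FC FU Ff Fg B.
have FI A1 A2 : F A1 -> F A2 -> F (A1 `&` A2).
  move=> FA1 FA2; pose A n := if n is 0%N then ~` A1 else ~` A2.
  have FCA : F (\bigcup_n A n) by apply: FU => -[|n]; rewrite /A -setTD; exact: FC.
  have -> : A1 `&` A2 = setT `\` \bigcup_n A n; last exact: FC.
  apply/seteqP; split=> w.
    by move=> [w1 w2]; split => // -[[|n] _ /=].
  move=> [_ wA]; split; apply: contrapT => nw; apply: wA; first by exists 0%N.
  by exists 1%N.
rewrite (_ : _ @^-1` B = \bigcup_n
  [set w | pickle (f w) = n /\ B (g (f w) w)]); last first.
  by apply/seteqP; split => [w Bw|w [n _ []//]]; exists (pickle (f w)).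
apply: FU => n.
have [[w0 w0n]|none] := pselect (exists w, pickle (f w) = n); last first.
  rewrite (_ : [set w | _] = set0)//; apply/seteqP; split => // w [fw _].
  by apply: none; exists w.
rewrite (_ : [set w | _] = f @^-1` [set f w0] `&` g (f w0) @^-1` B).
  exact: FI (Ff _) (Fg _ _).
apply/seteqP; split => w /=; rewrite -w0n.
  by move=> [/(pcan_inj pickleK) -> ?].
by move=> [-> ?].
Qed.

Lemma discrete_wrt_map (I : Type) (U : countType) (f : I -> T -> U) (s : seq I) :
  (forall i, discrete_wrt F (f i)) ->
  discrete_wrt F (fun w => [seq f i w | i <- s]).
Proof.
move=> Ff; elim: s => [|i s IHs] /=; first exact: discrete_wrt_cst.
apply: (@discrete_wrt_bind _ _ (f i) (fun u w => u :: [seq f i w | i <- s])) => // w.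
exact: (discrete_wrt_comp (cons (f i w))) IHs.
Qed.

Lemma discrete_wrt_iter_parent (z : nat -> T -> nat) t j s :
    (forall u w, (0 < u)%N -> (z u w < u)%N) ->
    (forall u, (u < t)%N -> discrete_wrt F (z u)) -> (s < t)%N ->
  discrete_wrt F (fun w => iter j (parent (z^~ w)) s).
Proof.
move=> zlt Fz; elim: j s => [|j IHj] s st; first exact: discrete_wrt_cst.
have Fp : discrete_wrt F (fun w => parent (z^~ w) s).
  by rewrite /parent; case: eqP => _; [exact: discrete_wrt_cst|exact: Fz].
under eq_fun => w do rewrite iterSr.
apply: (@discrete_wrt_bind _ _ _ (fun v w => iter j (parent (z^~ w)) v) Fp) => w.
apply: IHj; rewrite /parent; case: posnP => [_|s0]; first exact: leq_trans st.
exact: ltn_trans (zlt _ _ s0) st.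
Qed.

End DiscreteVariables.

(** * Height of a random recursive tree *)

Section RecursiveTree.
Variables (R : realType) (d : measure_display) (T : measurableType d).
Variables (P : probability T R) (F : nat -> set (set T)) (z : nat -> T -> nat).
Hypothesis sF : forall t, sigma_algebra setT (F t).
Hypothesis mF : forall t, F t `<=` measurable.
Hypothesis Fz : forall s t, (s < t)%N -> discrete_wrt (F t) (z s).
Hypothesis z_lt : forall t w, (0 < t)%N -> (z t w < t)%N.
Hypothesis z_le : forall t (v : 'I_t) E, F t E ->
  (P (E `&` [set w | z t w = v :> nat]) <= (2 / t%:R)%:E * P E)%E.

Let alive (j s : nat) : set T := [set w | iter j (parent (z^~ w)) s != 0%N].

Let F_alive j s t : (s < t)%N -> F t (alive j s).
Proof.
move=> st; have Fz' u : (u < t)%N -> discrete_wrt (F t) (z u) by exact: Fz.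
exact: (discrete_wrt_iter_parent (sF t) j z_lt Fz' st [set v | v != 0%N]).
Qed.

Let m_alive j s : measurable (alive j s).
Proof. exact: mF (F_alive j (ltnSn s)). Qed.

(* Split according to the parent of [t]; given the past, each value has
   probability at most 2 / t. *)
Let aliveS j t : (0 < t)%N ->
  (P (alive j.+1 t) <= (2 / t%:R)%:E * \sum_(v < t) P (alive j v))%E.
Proof.
move=> t0.
have mz v : measurable [set w | z t w = v].
  by apply: (mF (t := t.+1)); exact: (Fz (ltnSn t) [set v]).
have -> : alive j.+1 t =
    \big[setU/set0]_(v < t) (alive j v `&` [set w | z t w = v]).
  rewrite -(bigcup_mkord t (fun v => alive j v `&` [set w | z t w = v])).
  apply/seteqP; split => w; rewrite /alive /=.
    rewrite -iterS iterSr parentE// => zw.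
    by exists (z t w) => //=; exact: z_lt.
  by move=> [v /= vt [vw zw]]; rewrite -iterS iterSr parentE// zw.
have mA v (_ : (v < t)%N) := measurableI _ _ (m_alive j v) (mz v).
apply: le_trans (Boole_inequality P mA) _.
rewrite ge0_sume_distrr => [|v _]; last exact: measure_ge0.
by apply: lee_sum => v _; apply: z_le; exact: F_alive.
Qed.

(* The step is (t ^ 4 + 4 * t ^ 3) / 2 ^ j.+1 <= (t + 1) ^ 4 / 2 ^ j.+1. *)
Let sum_alive j t : (\sum_(s < t) P (alive j s) <= (t%:R ^+ 4 / 2 ^+ j)%:E)%E.
Proof.
elim: t j => [|t IHt] j; first by rewrite big_ord0 expr0n mul0r.
have [t0|t0] := posnP t.
  subst t; rewrite big_ord1 (_ : alive j 0 = set0).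
    by rewrite measure0 lee_fin divr_ge0.
  by apply/seteqP; split => // w; rewrite /alive /= iter_parent0.
case: j => [|j].
  apply: (@le_trans _ _ (\sum_(s < t.+1) 1)%E).
    by apply: lee_sum => s _; exact: probability_le1.
  rewrite sumEFin lee_fin sumr_const card_ord expr0 divr1 -natrX ler_nat.
  by rewrite -{1}[t.+1]expn1 leq_pexp2l.
rewrite big_ord_recr /=.
apply: (le_trans (leeD (IHt j.+1) (aliveS j t0))).
apply: (@le_trans _ _ ((t%:R ^+ 4 / 2 ^+ j.+1)%:E +
    (2 / t%:R)%:E * (t%:R ^+ 4 / 2 ^+ j)%:E)%E).
  by apply: leeD => //; apply: lee_wpmul2l; rewrite ?lee_fin ?divr_ge0.
rewrite -EFinM -EFinD lee_fin.
have tn0 : t%:R != 0 :> R by rewrite pnatr_eq0 -lt0n.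
have -> : t%:R ^+ 4 / 2 ^+ j.+1 + 2 / t%:R * (t%:R ^+ 4 / 2 ^+ j) =
    (t%:R ^+ 4 + 4 * t%:R ^+ 3) / 2 ^+ j.+1 :> R.
  rewrite [2 ^+ j.+1]exprS; field; rewrite expf_neq0//= ?tn0//.
rewrite ler_pM2r ?invr_gt0 ?exprn_gt0//.
rewrite -natr1; have : 0 <= t%:R :> R by []. nra.
Qed.

Lemma height_tail n k :
  (P (\big[setU/set0]_(s < n) alive k s) <= (n%:R ^+ 4 / 2 ^+ k)%:E)%E.
Proof.
by apply: le_trans (sum_alive k n); apply: Boole_inequality => s _.
Qed.

End RecursiveTree.

(** * Angles on the sphere *)

Section Sphere.
Variable R : realType.

Lemma radius_gt0 : 0 < Defs.radius R.
Proof. by rewrite invr_gt0 mulr_gt0// sqrtr_gt0 pi_gt0. Qed.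

Lemma sphere_dot (u : point3 R) : sphere u -> dot u u = Defs.radius R ^+ 2.
Proof.
rewrite /sphere /= => <-; rewrite sqr_sqrtr// /dot -!expr2.
by rewrite !addr_ge0// sqr_ge0.
Qed.

(** Expand the squares of the differences and of the sums of coordinates. *)
Lemma sphere_dot_itv (u v : point3 R) : sphere u -> sphere v ->
  -1 <= dot u v / (Defs.radius R * Defs.radius R) <= 1.
Proof.
move=> /sphere_dot su /sphere_dot sv; have r0 := radius_gt0.
rewrite -expr2 ler_pdivlMr ?ler_pdivrMr ?exprn_gt0// mulN1r mul1r.
move: su sv; rewrite /dot; set a := Defs.radius R ^+ 2.
move: u.1.1 u.1.2 u.2 v.1.1 v.1.2 v.2 => a1 a2 a3 b1 b2 b3 ha hb.
have := sqr_ge0 (a1 - b1); have := sqr_ge0 (a2 - b2); have := sqr_ge0 (a3 - b3).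
have := sqr_ge0 (a1 + b1); have := sqr_ge0 (a2 + b2); have := sqr_ge0 (a3 + b3).
by move=> ? ? ? ? ? ?; apply/andP; split; nra.
Qed.

(** [acos] takes an arbitrary value outside [[-1, 1]]; composed with [clamp] it
    is monotone on the whole line, hence measurable. *)
Definition clamp (x : R) : R := Num.max (-1) (Num.min 1 x).

Lemma acos_clamp_nonincreasing : nonincreasing_fun (acos \o clamp).
Proof.
have cI x : -1 <= clamp x <= 1.
  by rewrite /clamp le_max lexx ge_max ge_min lexx /= andbT; lra.
move=> y x /= xy; rewrite leNgt -ltr_cos ?in_itv/= ?acos_ge0 ?acos_lepi//.
by rewrite !acosK ?in_itv//= -leNgt; exact/le_max2/le_min2.
Qed.

End Sphere.

(** * Measurability of the random graphs *)

Section ProcessMeasurability.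
Variables (R : realType) (d : measure_display) (T : measurableType d).
Variables (m : nat) (X : process T R m) (r : R).
Hypothesis X_sphere : forall t w, sphere (pos X t w).

Let sM : sigma_algebra setT (@measurable d T) := sigma_algebra_measurable T.

Lemma discrete_wrt_measurable (f : {mfun T >-> nat}) :
  discrete_wrt measurable f.
Proof. by move=> B; rewrite -[_ @^-1` _]setTI; exact: measurable_funP. Qed.

Lemma measurable_dot (f g : {mfun T >-> point3 R}) :
  measurable_fun setT (fun w => dot (f w) (g w)).
Proof.
have mf : measurable_fun setT f by [].
have mg : measurable_fun setT g by [].
apply: measurable_funD; first apply: measurable_funD; apply: measurable_funM;
  do ?[exact: measurableT_comp measurable_snd _
      | apply: (measurableT_comp measurable_fst)
      | apply: (measurableT_comp measurable_snd)] => //.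
Qed.

Lemma discrete_wrt_near_new s t :
  discrete_wrt measurable (fun w => near_new r (posw X w) t s).
Proof.
have angleE w : angle (posw X w s) (posw X w t) =
    acos (clamp (dot (pos X s w) (pos X t w) / (Defs.radius R * Defs.radius R))).
  rewrite /angle /posw !(X_sphere _ w) /clamp.
  have /andP[ge1 le1] := sphere_dot_itv (X_sphere s w) (X_sphere t w).
  by rewrite min_r// max_r.
move=> B; rewrite /near_new; under eq_fun => w do rewrite angleE.
rewrite -[_ @^-1` _]setTI; apply: measurable_fun_ler => //.
apply: (@measurableT_comp _ _ _ _ _ _ (@acos R \o @clamp R)).
  by apply: nonincreasing_measurable => //; exact: acos_clamp_nonincreasing.
by apply: measurable_funM => //; exact: measurable_dot.
Qed.

Lemma discrete_wrt_isolated t :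
  discrete_wrt measurable (fun w => Defs.isolated r (posw X w) t).
Proof.
have -> : (fun w => Defs.isolated r (posw X w) t) =
    (fun w => all negb [seq near_new r (posw X w) t (val v) | v <- enum 'I_t]).
  apply/funext => w; rewrite all_map; apply/forallP/allP => /= H v *; first exact: H.
  by rewrite H// mem_enum.
apply: discrete_wrt_comp; apply: discrete_wrt_map => // v.
exact: discrete_wrt_near_new.
Qed.

Lemma discrete_wrt_local_edges t :
  discrete_wrt measurable (fun w => local_edges r (posw X w) (contactw X w) t).
Proof.
elim: t => [|t IHt] /=; first exact: discrete_wrt_cst.
apply: (discrete_wrt_bind sM (g := fun E w => E ++ if Defs.isolated r (posw X w) t then
  nseq (2 * m) (t, t) else [seq (t, contactw X w t i) | i <- enum 'I_m]) IHt) => w0.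
apply: (discrete_wrt_comp (cat _)).
apply: (discrete_wrt_bind sM (g := fun b w => if b then
  nseq (2 * m) (t, t) else [seq (t, contactw X w t i) | i <- enum 'I_m])
  (discrete_wrt_isolated t)) => w1.
case: (Defs.isolated _ _ _); first exact: discrete_wrt_cst.
apply: discrete_wrt_map => // i; apply: (discrete_wrt_comp (pair t)).
exact: discrete_wrt_measurable.
Qed.

Lemma discrete_wrt_long_edges t :
  discrete_wrt measurable (fun w => long_edges (extraw X w) t).
Proof.
apply: discrete_wrt_map => // s; apply: (discrete_wrt_comp (pair s)).
exact: discrete_wrt_measurable.
Qed.

Lemma discrete_wrt_flexible_edges k t :
  discrete_wrt measurable (fun w => flexible_edges (extraw X w) k t).
Proof.
elim: t => [|t IHt] /=; first exact: discrete_wrt_cst.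
case: eqP => _; first exact: discrete_wrt_comp (cat^~ _) _.
apply: (discrete_wrt_bind sM (g := fun E w => (t, extraw X w t) ::
  rem (t, t) (rem (extraw X w t, extraw X w t) (E ++ nseq k (t, t)))) IHt) => w0.
apply: (discrete_wrt_comp (fun v => (t, v) :: rem (t, t) (rem (v, v) _))).
exact: discrete_wrt_measurable.
Qed.

Lemma discrete_wrt_cat (f g : T -> edges) :
  discrete_wrt measurable f -> discrete_wrt measurable g ->
  discrete_wrt measurable (fun w => f w ++ g w).
Proof.
move=> mf mg; apply: (discrete_wrt_bind sM (g := fun E w => E ++ g w) mf) => w.
exact: discrete_wrt_comp.
Qed.

Lemma history_sigma_algebra a b c : sigma_algebra setT (history X a b c).
Proof. exact: smallest_sigma_algebra. Qed.

Lemma history_measurable a b c : history X a b c `<=` measurable.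
Proof.
apply: smallest_sub; first exact: sigma_algebra_measurable.
move=> A [[]|]; first by move=> [s _ [B mB <-]]; exact: measurable_funP.
  by move=> [s _ [i _ [B mB <-]]]; exact: measurable_funP.
by move=> [s _ [B mB <-]]; exact: measurable_funP.
Qed.

Lemma history_extra a b c s : (s < c)%N -> discrete_wrt (history X a b c) (extra X s).
Proof.
move=> sc B; apply: sub_gen_smallest; right; exists s => //.
by exists B => //; rewrite setTI.
Qed.

End ProcessMeasurability.

(** * Diameter bound *)

Lemma measurable_diameter_le (R : realType) (d : measure_display)
    (T : measurableType d) (G : T -> edges) n (x : \bar R) :
  discrete_wrt measurable G -> measurable [set w | (diameter R n (G w) <= x)%E].
Proof. by move=> mG; exact: (mG [set E | (diameter R n E <= x)%E]). Qed.

(** Apply [height_tail] at height [k = trunc (10 * ln n)]: the tail is at most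
    [n ^ 4 / 2 ^ k], and [n ^ 5 <= 2 ^ k.+1] because
    [n = expR (ln n)] and [expR (1 / 2) <= 2]. *)
Lemma diameter_le_20ln_prob (R : realType) (d : measure_display)
    (T : measurableType d) (P : probability T R) (m : nat) (X : process T R m)
    (G : T -> edges) n :
    (0 < n)%N ->
    discrete_wrt measurable G ->
    (forall t w, (0 < t)%N -> (extra X t w < t)%N) ->
    (forall t (v : 'I_t) E, history X t.+1 t.+1 t E ->
      (P (E `&` [set w | extra X t w = v :> nat]) <= (2 / t%:R)%:E * P E)%E) ->
    (forall w s, (0 < s < n)%N -> (s, extra X s w) \in G w) ->
  ((1 - 2 * n%:R^-1)%:E <=
     P [set w | (diameter R n (G w) <= (20 * ln n%:R)%:E)%E])%E.
Proof.
move=> n0 mG zlt zle GE.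
have n1 : 1 <= n%:R :> R by rewrite ler1n.
have ln0 : 0 <= 10 * ln n%:R :> R by rewrite mulr_ge0// ln_ge0.
pose k := Num.truncn (10 * ln n%:R :> R).
have /andP[k_le k_gt] := truncn_itv ln0; rewrite -/k in k_le k_gt.
pose z s w := extra X s w.
pose tall := \big[setU/set0]_(s < n) [set w | iter k (parent (z^~ w)) s != 0%N].
have Fz s t : (s < t)%N -> discrete_wrt (history X t.+1 t.+1 t) (z s).
  exact: history_extra.
have mz s : discrete_wrt measurable (z s) by exact: discrete_wrt_measurable.
have mtall : measurable tall.
  apply: bigsetU_measurable => s _.
  exact: (discrete_wrt_iter_parent (sigma_algebra_measurable T) k zlt
    (fun u _ => mz u) (ltnSn s) [set v | v != 0%N]).
have tail : (P tall <= (n%:R ^+ 4 / 2 ^+ k)%:E)%E.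
  exact: (height_tail (fun t => history_sigma_algebra X t.+1 t.+1 t)
    (fun t => @history_measurable _ _ _ _ X t.+1 t.+1 t) Fz zlt zle).
have pow2 : n%:R ^+ 5 <= 2 ^+ k.+1 :> R.
  have e2 : expR (2^-1) <= 2 :> R.
    have := expR_ge1Dx (- 2^-1 : R); rewrite expRN => h.
    rewrite -[leRHS]invrK -[leLHS]invrK lef_pV2 ?posrE ?invr_gt0 ?expR_gt0//.
    by apply: le_trans h; lra.
  apply: (@le_trans _ _ (expR (2^-1) ^+ k.+1)).
    rewrite -expRM_natl -[n%:R]lnK ?posrE ?ltr0n// -expRM_natl ler_expR; lra.
  by rewrite lerXn2r ?nnegrE ?expR_ge0.
apply: (@le_trans _ _ (P (~` tall))).
  rewrite probability_setC// EFinB; apply: leeB => //; apply: (le_trans tail).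
  rewrite lee_fin ler_pdivrMr ?exprn_gt0// mulrAC ler_pdivlMr ?ltr0n//.
  by rewrite -exprSr -exprS.
apply: le_measure; rewrite ?inE; [exact: measurableC|exact: measurable_diameter_le|].
move=> w /= short.
apply: (le_trans (diameter_le_double_height (z := z^~ w) (k := k) R _ _)).
- by move=> s /andP[s0 sn]; rewrite zlt// GE// s0.
- move=> s sn; apply/eqP; apply: contrapT => /negP alive; apply: short.
  rewrite /tall -(bigcup_mkord n
    (fun s => [set w | iter k (parent (z^~ w)) s != 0%N])).
  by exists s.
- by rewrite lee_fin; lra.
Qed.

(** Integrate the bound on the conditional probability over [E]. *)
Lemma cond_prob_le (R : realType) (d : measure_display) (T : measurableType d)
    (P : probability T R) (F : set (set T)) (A : set T) (p : T -> R) (c : R) E :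
    F `<=` measurable -> cond_prob P F A p -> (forall w, 0 <= p w <= c) -> F E ->
  (P (E `&` A) <= c%:E * P E)%E.
Proof.
move=> mF [mp PE] pc FE; have mE := mF _ FE.
rewrite PE// -integral_cst//; apply: ge0_le_integral => //.
- by move=> w _; rewrite lee_fin; case/andP: (pc w).
- apply/measurable_EFinP; apply: (@measurable_funS _ _ _ _ setT) => //.
  by move=> _ B mB; rewrite setTI; exact/mF/mp.
- by move=> w _; rewrite lee_fin; case/andP: (pc w).
Qed.

Lemma whp_of_lower_bound (R : realType) (d : nat -> measure_display)
    (T : forall n, measurableType (d n)) (P : forall n, probability (T n) R)
    (A : forall n, set (T n)) (c : R) :
    (forall n, measurable (A n)) ->
    (\forall n \near \oo, ((1 - c * n%:R^-1)%:E <= P n (A n))%E) ->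
  whp P A.
Proof.
move=> mA lowA; apply: (@squeeze_cvge _ _ _ _ (fun n => (1 - c * n%:R^-1)%:E) _ (cst 1%E)).
- near=> n; rewrite probability_le1// andbT; near: n; exact: lowA.
- apply: cvg_EFin; first by near=> n.
  rewrite -[X in _ --> X]subr0; apply: cvgB; first exact: cvg_cst.
  rewrite -[X in _ --> X](mulr0 c); apply: cvgMr.
  apply/gtr0_cvgV0; last exact: cvgr_idn.
  by near=> n; rewrite ltr0n; near: n; exact: nbhs_infty_gt.
- exact: cvg_cst.
Unshelve. all: by end_near.
Qed.

Theorem theorem1 (R : realType) (xi : R) (xi_gt0 : 0 < xi) :
  (exists C : R,
    forall (m : nat -> nat) (r : nat -> R)
      (d : nat -> measure_display) (T : forall n, measurableType (d n))
      (P : forall n, probability (T n) R)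
      (X : forall n, process (T n) R (m n)),
    (forall n, (1 <= m n)%N) ->
    (forall n, 0 < r n) ->
    (forall n, hybrid_model (P n) (X n) (r n) (xi * (m n)%:R)) ->
    whp P (fun n => [set w |
      (diameter R n (hybrid_graph (X n) (r n) n w) <= (C * ln n%:R)%:E)%E]))
  /\
  (exists K1 C : R,
    forall (m : nat -> nat) (r : nat -> R) (delta : nat -> nat)
      (d : nat -> measure_display) (T : forall n, measurableType (d n))
      (P : forall n, probability (T n) R)
      (X : forall n, process (T n) R (m n)),
    (forall n, (1 <= m n)%N) ->
    (forall n, K1 * ln n%:R <= (m n)%:R) ->
    (forall n, 0 < r n) ->
    (forall n, (2 <= delta n)%N) ->
    (forall n, (delta n)%:R = xi * (m n)%:R) ->
    (forall n, self_loop_model (P n) (X n) (r n) (delta n)) ->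
    whp P (fun n => [set w |
      (diameter R n (self_loop_graph (X n) (r n) (delta n) n w)
         <= (C * ln n%:R)%:E)%E])).
Proof.
split.
  exists 20 => m r d T P X _ _ model.
  have mG n : discrete_wrt measurable (hybrid_graph (X n) (r n) n).
    have [[X_sphere _ _ _] _ _] := model n.
    by apply: discrete_wrt_cat;
      [exact: discrete_wrt_local_edges|exact: discrete_wrt_long_edges].
  apply: (whp_of_lower_bound (c := 2)) => [n|]; first exact: measurable_diameter_le.
  near=> n; have [_ z_lt z_law] := model n.
  apply: (diameter_le_20ln_prob (X := X n)) => //; first by near: n; exact: nbhs_infty_gt.
    move=> t v E FE; apply: cond_prob_le (z_law t v) _ FE.
      exact: history_measurable.
    by move=> _; rewrite invr_ge0 ler0n /= ler_peMl ?invr_ge0 ?ler1n.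
  move=> w s /andP[s0 sn]; rewrite mem_cat; apply/orP; right.
  by apply/map_f; rewrite mem_iota s0/= add1n prednK// (leq_ltn_trans _ sn).
exists 1, 20 => m r delta d T P X _ m_ge _ _ deltaE model.
have mG n : discrete_wrt measurable (self_loop_graph (X n) (r n) (delta n) n).
  have [[X_sphere _ _ _] _ _] := model n.
  by apply: discrete_wrt_cat;
    [exact: discrete_wrt_local_edges|exact: discrete_wrt_flexible_edges].
apply: (whp_of_lower_bound (c := 2)) => [n|]; first exact: measurable_diameter_le.
near=> n; have [_ z_lt z_law] := model n.
have n0 : (0 < n)%N by near: n; exact: nbhs_infty_gt.
(* [m >= ln n >= 4 / xi] once [n >= expR (4 / xi)]. *)
have delta4 : (3 < delta n)%N.
  rewrite -(ler_nat R) deltaE mulrC -ler_pdivrMr//.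
  apply: le_trans (m_ge n); rewrite mul1r -[leLHS]expRK ler_ln ?posrE ?expR_gt0 ?ltr0n//.
  by near: n; exact: nbhs_infty_ger.
apply: (diameter_le_20ln_prob (X := X n)) => //.
  move=> t v E FE; apply: cond_prob_le (z_law t v) _ FE.
    exact: history_measurable.
  move=> w; have t0 : (0 < t)%N by rewrite (leq_ltn_trans _ (ltn_ord v)).
  case: ifP => [vl|_]; last by rewrite lexx divr_ge0.
  rewrite invr_ge0 ler0n/=.
  have := half_have_flexible_loop (t := t) (z := extraw (X n) w) delta4
    (fun s h => z_lt s w (proj1 (andP h))).
  set c := #|_| => half.
  have c0 : (0 < c)%N by move: half t0; case: (c) => //; lia.
  rewrite -[leLHS]mul1r ler_pdivrMr ?ltr0n// mulrAC ler_pdivlMr ?ltr0n// mul1r.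
  by rewrite -natrM ler_nat.
move=> w s sn; rewrite mem_cat; apply/orP; right.
by apply: flexible_edge_mem => // u /andP[u0 _]; exact: z_lt.
Unshelve. all: by end_near.
Qed.
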